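(* Let $p$ be a prime, let $G$ be a finite group, let $B$ be a $p$-block of $G$ with defect group $D$, and let $x\in D$. Then $x$ is $B$-real if and only if $x$ is real in $G$.
   Context: $\mathrm{Irr}(B)$ is the set of irreducible ordinary (complex) characters in the block $B$. An element $x\in D$ is $B$-real if $\chi(x)$ is a real number for every $\chi\in\mathrm{Irr}(B)$. An element of $G$ is real in $G$ if it is conjugate in $G$ to its inverse. *)

(* Defs.v *)
From HB Require Import structures.
From mathcomp Require Import all_boot all_order all_algebra all_fingroup.
From mathcomp Require Import all_solvable all_field all_character.

Set Implicit Arguments.
Unset Strict Implicit.
Unset Printing Implicit Defensive.

Import Order.TTheory GroupScope GRing.Theory Num.Theory.
Local Open Scope ring_scope.

(* Proper ideals of the ring Aint of algebraic integers, i.e. idealr_closed   *)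
(* with Aint, which is only a predicate on algC, as the ambient ring.         *)
Definition Aint_proper_ideal (I : {pred algC}) : Prop :=
  [/\ {subset I <= Aint}, 0 \in I, 1 \notin I
    & {in Aint, forall a, {in I &, forall u v, a * u + v \in I}}].

Definition Aint_maximal_ideal (M : {pred algC}) : Prop :=
  Aint_proper_ideal M /\
  forall J : {pred algC},
    Aint_proper_ideal J -> {subset M <= J} -> {subset J <= M}.

(* For the localization S = {r / s : r, s in Aint, s not in M} of Aint at M:  *)
(* a lies in S and has nonzero image in the residue field S / MS = Aint / M.  *)
Definition nonzero_mod (M : {pred algC}) (a : algC) : Prop :=
  exists r s : algC,
    [/\ r \in Aint, r \notin M, s \in Aint, s \notin M & a = r / s].

(* p-blocks are taken with respect to a maximal ideal M of Aint containing p; *)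
(* neither they nor their defect groups depend on the choice of M.  A block B *)
(* is represented by the set of the indices of the characters in Irr(B).      *)
Section Blocks.

Variables (gT : finGroupType) (G : {group gT}) (M : {pred algC}).

(* 'omega_i['K_k] is the value |K| chi_i(g) / chi_i(1), for g in K, of the    *)
(* central character of chi_i at the sum of the k-th conjugacy class K of G.  *)
Definition same_block (i j : Iirr G) : bool :=
  [forall k : 'I_#|classes G|, 'omega_i['K_k] - 'omega_j['K_k] \in M].

Definition is_block (B : {set Iirr G}) : Prop :=
  exists i : Iirr G, B = [set j | same_block i j].

(* The coefficient at g of the central idempotent of the complex group        *)
(* algebra attached to B; its reduction mod M is the coefficient at g of the  *)
(* block idempotent of B over the residue field Aint / M.                     *)
Definition block_coef (B : {set Iirr G}) (g : gT) : algC :=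
  #|G|%:R^-1 * \sum_(i in B) 'chi_i 1%g * 'chi_i (g^-1)%g.

(* A defect class of B is a conjugacy class at which both the block           *)
(* idempotent and the central character of B are nonzero mod M.               *)
Definition defect_class (B : {set Iirr G}) (k : 'I_#|classes G|) : Prop :=
  {in enum_val k, forall g, nonzero_mod M (block_coef B g)} /\
  {in B, forall i, 'omega_i['K_k] \notin M}.

Definition defect_group (p : nat) (B : {set Iirr G}) (D : {group gT}) : Prop :=
  exists k : 'I_#|classes G|,
    defect_class B k /\ exists2 g, g \in enum_val k & p.-Sylow('C_G[g]) D.

End Blocks.

Definition block_real (gT : finGroupType) (G : {group gT})
    (B : {set Iirr G}) (x : gT) : Prop :=
  {in B, forall i, 'chi_i x \is Num.real}.

Definition real_in (gT : finGroupType) (G : {group gT}) (x : gT) : Prop :=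
  exists2 g, g \in G & (x ^ g)%g = (x^-1)%g.

(* Main.v *)
(* For x in D put e = e_B, an idempotent with coefficients in the local ring S
   of Aint at M.  For z in G the trace of a |-> x a z^-1 on e CG is
   sum_(chi in B) chi(x) chi(z^-1).  Now SG is a permutation module for the
   cyclic p-group generated by this map; the endomorphism ring of the module
   of an orbit is local, so e SG is again a permutation module, whose trivial
   summands can be read off from e modulo MS on the fixed points
   {a | x^a = z}.
   If x is not real, there are no fixed points for z = x^-1, whence
   sum_(chi in B) chi(x)^2 = 0.  For z = x the fixed points form C_G(x), which
   contains 1 and an element g of a defect class, at which e is nonzero modulo
   MS; hence sum_(chi in B) |chi(x)|^2 is not 0.  So x cannot be B-real. *)
Require Import Defs.
From mathcomp Require Import all_boot all_order all_algebra all_fingroup.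
From mathcomp Require Import all_solvable all_field all_character.
From HB Require Import structures.
From mathcomp Require Import boolp ring.

Set Implicit Arguments.
Unset Strict Implicit.
Unset Printing Implicit Defensive.
Import Order.TTheory GroupScope GRing.Theory Num.Theory.
Local Open Scope ring_scope.

(** * The localization S of the algebraic integers at M and its maximal ideal MS *)

Section Localization.

Variables (M : {pred algC}) (maxM : Aint_maximal_ideal M).

Let M_Aint a : a \in M -> a \in Aint.
Proof. by case: maxM => -[sM _ _ _] _ /sM. Qed.

Let M1 : 1 \notin M.
Proof. by case: maxM => -[]. Qed.

Let MMD a u v : a \in Aint -> u \in M -> v \in M -> a * u + v \in M.
Proof. by case: maxM => -[_ _ _ idM] _ Aa Mu Mv; apply: idM. Qed.

Let M0 : 0 \in M.
Proof. by case: maxM => -[]. Qed.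

Let MM a u : a \in Aint -> u \in M -> a * u \in M.
Proof. by move=> Aa Mu; rewrite -[a * u]addr0 MMD. Qed.

(** Maximality is tested on the ideal [J] generated by M and a. If 1 = u + a v with u in M, then b =
    b u + a b v lies in M; if 1 is not in [J], then [J] lies in M and contains a. *)
Lemma Aint_max_prime a b :
  a \in Aint -> b \in Aint -> a * b \in M -> (a \in M) || (b \in M).
Proof.
move=> Aa Ab Mab; have [//|M'a /=] := boolP (a \in M).
pose J : {pred algC} :=
  fun c => `[< exists u v, [/\ u \in M, v \in Aint & c = u + a * v] >].
have [/asboolP[u [v [Mu Av D1]]] | J'1] := boolP (1 \in J).
  by rewrite -[b]mulr1 D1 mulrDr MMD // mulrCA mulrA mulrC MM.
case/negP: M'a; case: maxM => _ maxJ; apply: (maxJ J); first last.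
- by apply/asboolP; exists 0, 1; split=> //; rewrite ?rpred1 ?add0r ?mulr1.
- by move=> c Mc; apply/asboolP; exists c, 0; split=> //;
  rewrite ?rpred0 ?mulr0 ?addr0.
split=> //.
- move=> c /asboolP[u [v [Mu Av ->]]].
  by apply: rpredD; [apply: M_Aint | apply: rpredM].
- by apply/asboolP; exists 0, 0; split=> //; rewrite ?rpred0 ?mulr0 ?addr0.
move=> c Ac _ _ /asboolP[u [v [Mu Av ->]]] /asboolP[w [z [Mw Az ->]]].
apply/asboolP; exists (c * u + w), (c * v + z); split.
- exact: MMD.
- by rewrite rpredD ?rpredM.
by rewrite !mulrDr mulrCA addrACA.
Qed.

(* S and MS, in the notation of the comment on [nonzero_mod]; the unused
   argument mM lets the closure instances below depend on the maximality of M. *)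
Definition loc_Aint (mM : Aint_maximal_ideal M) : {pred algC} := fun a =>
  `[< exists r s, [/\ r \in Aint, s \in Aint, s \notin M & a = r / s] >].

Definition loc_max (mM : Aint_maximal_ideal M) : {pred algC} := fun a =>
  `[< exists r s, [/\ r \in M, s \in Aint, s \notin M & a = r / s] >].

Let nzM s : s \notin M -> s != 0.
Proof. by apply: contraNneq => ->. Qed.

Let M'M s t : s \in Aint -> t \in Aint -> s \notin M -> t \notin M ->
  s * t \notin M.
Proof.
move=> As At M's M't; apply/negP => /(Aint_max_prime As At).
by rewrite (negPf M's) (negPf M't).
Qed.

Lemma loc_subring_closed : subring_closed (loc_Aint maxM).
Proof.
split.
- by apply/asboolP; exists 1, 1; split=> //; rewrite ?rpred1 ?divr1.
- move=> _ _ /asboolP[r [s [Ar As Ms ->]]] /asboolP[t [u [At Au Mu ->]]].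
  apply/asboolP; exists (r * u - t * s), (s * u).
  rewrite rpredB ?rpredM // M'M //; split=> //.
  by rewrite -mulNr addf_div ?nzM // mulNr.
move=> _ _ /asboolP[r [s [Ar As Ms ->]]] /asboolP[t [u [At Au Mu ->]]].
apply/asboolP; exists (r * t), (s * u).
by rewrite !rpredM // M'M //; split=> //; rewrite mulf_div.
Qed.

HB.instance Definition _ :=
  GRing.isSubringClosed.Build algC (loc_Aint maxM) loc_subring_closed.

Lemma loc_max_addr_closed : addr_closed (loc_max maxM).
Proof.
split; first by apply/asboolP; exists 0, 1; split=> //; rewrite ?rpred1 ?mul0r.
move=> _ _ /asboolP[r [s [Mr As Ms ->]]] /asboolP[t [u [Mt Au Mu ->]]].
apply/asboolP; exists (r * u + t * s), (s * u).
rewrite rpredM // M'M // mulrC MMD ?[t * s]mulrC ?MM //; split=> //.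
by rewrite addf_div ?nzM // [u * r]mulrC [s * t]mulrC.
Qed.

HB.instance Definition _ :=
  GRing.isAddClosed.Build algC (loc_max maxM) loc_max_addr_closed.

Lemma loc_maxM a b :
  a \in loc_Aint maxM -> b \in loc_max maxM -> a * b \in loc_max maxM.
Proof.
case/asboolP=> r [s [Ar As Ms ->]] /asboolP[t [u [Mt Au Mu ->]]].
by apply/asboolP; exists (r * t), (s * u); rewrite mulf_div MM // rpredM ?M'M.
Qed.

Lemma loc_maxMr a b :
  a \in loc_max maxM -> b \in loc_Aint maxM -> a * b \in loc_max maxM.
Proof. by move=> ma Sb; rewrite mulrC loc_maxM. Qed.

Lemma loc_maxN a : (- a \in loc_max maxM) = (a \in loc_max maxM).
Proof.
have N b : b \in loc_max maxM -> - b \in loc_max maxM.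
  by move=> mb; rewrite -mulN1r loc_maxM // rpredN1.
by apply/idP/idP=> /N //; rewrite opprK.
Qed.

Lemma loc_maxB a b :
  a \in loc_max maxM -> b \in loc_max maxM -> a - b \in loc_max maxM.
Proof. by move=> ma mb; rewrite rpredD ?loc_maxN. Qed.

Lemma Aint_loc a : a \in Aint -> a \in loc_Aint maxM.
Proof.
by move=> Aa; apply/asboolP; exists a, 1; split=> //; rewrite ?rpred1 ?divr1.
Qed.

Lemma ideal_loc_max a : a \in M -> a \in loc_max maxM.
Proof.
by move=> Ma; apply/asboolP; exists a, 1; split=> //; rewrite ?rpred1 ?divr1.
Qed.

Lemma loc_unit a : a \in loc_Aint maxM -> a \notin loc_max maxM ->
  a^-1 \in loc_Aint maxM.
Proof.
case/asboolP=> r [s [Ar As Ms Da]] /asboolPn m'a.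
apply/asboolP; exists s, r; rewrite Da invf_div; split=> //.
by apply/negP => Mr; case: m'a; exists r, s.
Qed.

Lemma Aint_loc_max a : a \in Aint -> (a \in loc_max maxM) = (a \in M).
Proof.
move=> Aa; apply/asboolP/idP=> [[r [s [Mr As Ms Da]]] | Ma]; last first.
  by exists a, 1; split=> //; rewrite ?rpred1 ?divr1.
have: a * s \in M by rewrite Da divfK ?nzM.
by case/(Aint_max_prime Aa As)/orP=> // /idPn.
Qed.

Lemma loc_max1 : 1 \notin loc_max maxM.
Proof. by rewrite Aint_loc_max ?rpred1. Qed.

Lemma loc_max_prime a b : a \in loc_Aint maxM -> b \in loc_Aint maxM ->
  a * b \in loc_max maxM -> (a \in loc_max maxM) || (b \in loc_max maxM).
Proof.
move=> Sa Sb mab; have [//|m'a /=] := boolP (a \in loc_max maxM).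
have nz_a: a != 0 by apply: contraNneq m'a => ->; apply: rpred0.
by rewrite -[b](mulKf nz_a) loc_maxM ?loc_unit.
Qed.

Lemma loc_max_nunit a : a \in loc_Aint maxM -> nonzero_mod M a ->
  a \notin loc_max maxM.
Proof.
move=> Sa [r [s [Ar M'r As M's Da]]]; apply/negP=> ma.
case/negP: M'r; rewrite -Aint_loc_max // -[r](divfK (nzM M's)) -Da mulrC.
by rewrite loc_maxM ?Aint_loc.
Qed.

Lemma loc_max_prod (I : finType) (P : pred I) (F : I -> algC) :
  (forall i, P i -> (F i \in loc_Aint maxM) && (F i \notin loc_max maxM)) ->
  \prod_(i | P i) F i \notin loc_max maxM.
Proof.
move=> u_F; suffices /andP[]: (\prod_(i | P i) F i \in loc_Aint maxM)
                           && (\prod_(i | P i) F i \notin loc_max maxM) by [].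
elim/big_ind: _ => // [|a b]; first by rewrite rpred1 loc_max1.
move=> /andP[Sa m'a] /andP[Sb m'b]; rewrite rpredM //=.
by apply/negP=> /(loc_max_prime Sa Sb); rewrite (negPf m'a) (negPf m'b).
Qed.

(** As p lies in M, the binomial formula makes eta^p - 1 congruent to (eta - 1)^p modulo MS;
    primality of MS then allows induction on e. *)
Lemma loc_max_unity_root p e eta : prime p -> p%:R \in M ->
  eta ^+ (p ^ e) = 1 -> eta - 1 \in loc_max maxM.
Proof.
move=> p_pr Mp; elim: e eta => [|e IHe] eta.
  by rewrite expr1 => ->; rewrite subrr rpred0.
rewrite expnS exprM => eta1; have /IHe := eta1.
have Aeta: eta \in Aint.
  apply: (@Aint_unity_root (p ^ e.+1)); first by rewrite expn_gt0 prime_gt0.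
  by rewrite unity_rootE expnS exprM eta1.
set t := eta - 1; have At: t \in Aint by rewrite rpredB ?rpred1.
have -> : eta = 1 + t by rewrite addrC subrK.
have mbinom: (1 + t) ^+ p - 1 - t ^+ p \in loc_max maxM.
  case: p p_pr Mp {IHe eta1} => // k k_pr Mk.
  rewrite exprDn big_ord_recl big_ord_recr /= /bump !add1n !expr1n !mul1r.
  rewrite expr0 bin0 binn !mulr1n [1 + _]addrC !addrK rpred_sum // => i _.
  rewrite expr1n mul1r -mulr_natl.
  have /dvdnP[m ->]: (k.+1 %| 'C(k.+1, 1 + i))%N.
    by apply: prime_dvd_bin => //; apply: (ltn_ord i).
  rewrite mulrC loc_maxM ?Aint_loc ?rpredX // natrM.
  by rewrite loc_maxM ?ideal_loc_max ?rpred_nat.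
move=> /loc_maxB/(_ mbinom); rewrite opprB [_ + (_ - _)]addrC subrK => mt.
elim: p {p_pr Mp IHe eta1 mbinom} mt => [|k IHk].
  by rewrite (negPf loc_max1).
rewrite exprS => /loc_max_prime; rewrite !(Aint_loc, rpredX) //.
by case/(_ isT isT)/orP.
Qed.

End Localization.

(** Every term of the expanded product except 1 has a factor f. Thus [k] inverts f modulo any
    divisor of the product. *)
Lemma prod_1subZ_polyOver (R : comNzRingType) (S : subringClosed R)
    (r : seq R) (f : {poly R}) :
  f \is a polyOver S -> {subset r <= S} ->
  exists2 k, k \is a polyOver S & \prod_(c <- r) (1 - c *: f) = 1 - f * k.
Proof.
move=> Sf; elim: r => [|c r IHr] Sr.
  by exists 0; rewrite ?rpred0 // big_nil mulr0 subr0.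
have [|k Sk Dk] := IHr; first by move=> d rd; rewrite Sr // inE rd orbT.
exists (c%:P + k - c *: (f * k)).
  rewrite rpredB ?rpredD ?polyOverC ?polyOverZ ?rpredM ?Sr ?inE ?eqxx //.
by rewrite big_cons Dk -!mul_polyC; ring.
Qed.

(** * Idempotents over S commuting with a permutation of p-power order *)

Section LocalIdempotent.

Variables (M : {pred algC}) (maxM : Aint_maximal_ideal M).
Variables (p e : nat) (p_pr : prime p) (Mp : p%:R \in M).

Let S := loc_Aint maxM.

(* At every q-th root of unity eta the value f(eta) = f(1) mod MS is a unit,
   so X - eta divides 1 - f / f(eta), and X^q - 1 divides their product. *)
Lemma poly_inv_mod_Xn_sub_1 (f : {poly algC}) :
    f \is a polyOver S -> f.[1] \notin loc_max maxM ->
  exists2 k, k \is a polyOver S & 'X^(p ^ e) - 1 %| 1 - f * k.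
Proof.
move=> Sf m'f1; have q_gt0: (0 < p ^ e)%N by rewrite expn_gt0 prime_gt0.
have [z prim_z] := C_prim_root_exists q_gt0.
have Sz i: z ^+ i \in S.
  apply/rpredX/Aint_loc/(Aint_unity_root q_gt0).
  by rewrite unity_rootE (prim_expr_order prim_z).
have Sfz i : f.[z ^+ i] \in S by apply: rpred_horner.
have m'fz i: f.[z ^+ i] \notin loc_max maxM.
  (* The values of f at eta = [z ^+ i] and at 1 differ by the sum of the f_j (eta^j - 1), whose
     terms all lie in MS. *)
  apply: contra m'f1 => mfz; rewrite -[_.[1]](subKr f.[z ^+ i]).
  rewrite loc_maxB // !horner_coef -sumrB rpred_sum // => j _.
  rewrite expr1n -mulrBr loc_maxM ?(polyOverP Sf) //.
  apply: (loc_max_unity_root maxM (e := e) p_pr Mp).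
  by rewrite -!exprM mulnA mulnC exprM (prim_expr_order prim_z) expr1n.
pose r := [seq (f.[z ^+ i])^-1 | i <- index_iota 0 (p ^ e)].
have [|k Sk Dk] := @prod_1subZ_polyOver _ S r f Sf.
  by move=> _ /mapP[i _ ->]; apply: loc_unit.
exists k => //; rewrite -Dk -(factor_Xn_sub_1 prim_z) big_map.
apply: (big_ind2 (fun g h => g %| h)) => // [g1 h1 g2 h2|i _].
  exact: dvdp_mul.
rewrite dvdp_XsubCl rootE !hornerE mulVf ?subrr //.
by apply: contraNneq (m'fz i) => ->; apply: rpred0.
Qed.

Variables (n : nat) (s : 'S_n.+1) (sq1 : (s ^+ (p ^ e) = 1)%g).

Let P : 'M[algC]_n.+1 := perm_mx s.

Definition proj_mx_on (A : {set 'I_n.+1}) : 'M[algC]_n.+1 :=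
  diag_mx (\row_i (i \in A)%:R).

Local Notation J := proj_mx_on.

Lemma mul_proj_mx_on m A (B : 'M_(n.+1, m)) i j :
  (J A *m B) i j = (i \in A)%:R * B i j.
Proof. by rewrite mul_diag_mx !mxE. Qed.

Lemma mul_mx_proj_on m A (B : 'M_(m, n.+1)) i j :
  (B *m J A) i j = B i j * (j \in A)%:R.
Proof. by rewrite mul_mx_diag !mxE. Qed.

Lemma proj_mx_onD A B : J (A :\: B) = J A - J B *m J A.
Proof.
apply/matrixP=> i j; rewrite [RHS]mxE [X in _ = _ + X]mxE.
rewrite mul_proj_mx_on !mxE !inE.
by case: (i \in A); case: (i \in B);
  rewrite ?mul1r ?mul0r ?subr0 ?subrr ?mul0rn.
Qed.

Lemma proj_mx_onM A B : J A *m J B = J (A :&: B).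
Proof.
apply/matrixP=> i j; rewrite mul_proj_mx_on !mxE !inE.
by case: (i \in A); case: (i \in B); rewrite ?mul1r ?mul0r ?mul0rn.
Qed.

Lemma mul_perm_mxE m (B : 'M[algC]_(n.+1, m)) i j : (P *m B) i j = B (s i) j.
Proof. by rewrite -row_permE mxE. Qed.

Lemma comm_perm_mxP (B : 'M[algC]_n.+1) :
  B *m P = P *m B <-> forall i j, B (s i) (s j) = B i j.
Proof.
have BPE i j : (B *m P) i (s j) = B i j.
  by rewrite /P -[s in perm_mx s]invgK -col_permE mxE permK.
split=> [cBP i j | sB]; first by rewrite -mul_perm_mxE -cBP BPE.
by apply/matrixP=> i j; rewrite -[j](permKV s) BPE mul_perm_mxE sB.
Qed.

Lemma comm_proj_mx_on (A : {set _}) :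
  (forall i, (s i \in A) = (i \in A)) -> J A *m P = P *m J A.
Proof.
by move=> sA; apply/comm_perm_mxP=> i j; rewrite !mxE sA (inj_eq perm_inj).
Qed.

Lemma perm_mxX k : P ^+ k = perm_mx (s ^+ k)%g.
Proof.
elim: k => [|k IHk]; first by rewrite perm_mx1.
by rewrite exprS expgS perm_mxM IHk.
Qed.

(** A projection onto a direct summand of the permutation module on A. Cutting the support down with
    [J A] keeps the matrix size fixed while orbits are removed. *)
Definition loc_idem (A : {set 'I_n.+1}) (E : 'M[algC]_n.+1) : Prop :=
  [/\ E \is a mxOver S, E *m E = E, E *m P = P *m E, J A *m E = E
    & E *m J A = E].

(** The entries at pairs of fixed points are what survives modulo MS when moved orbits are split
    off. *)
Definition fix_cong (E F : 'M[algC]_n.+1) : Prop :=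
  forall i j, s i = i -> s j = j -> F i j - E i j \in loc_max maxM.

Lemma loc_idem_compl (A : {set _}) E : (forall i, (s i \in A) = (i \in A)) ->
  loc_idem A E -> loc_idem A (J A - E).
Proof.
move=> sA [SE EE EP AE EA]; have AA: J A *m J A = J A.
  by rewrite proj_mx_onM setIid.
split.
- apply/mxOverP=> i j; rewrite !mxE rpredB ?(mxOverP SE) //.
  by rewrite rpredMn ?rpred_nat.
- by rewrite mulmxBl !mulmxBr AA EE AE EA subrr subr0.
- by rewrite mulmxBl mulmxBr EP comm_proj_mx_on.
- by rewrite mulmxBr AA AE.
by rewrite mulmxBl AA EA.
Qed.

Lemma row_fix_horner_mx m (v : 'M[algC]_(m, n.+1)) (k : {poly algC}) :
  v *m P = v -> v *m horner_mx P k = k.[1] *: v.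
Proof.
move=> vP; elim/poly_ind: k => [|k c IHk].
  by rewrite rmorph0 horner0 scale0r mulmx0.
rewrite rmorphD rmorphM /= horner_mx_X horner_mx_C mulmxDr mulmxA IHk.
by rewrite -scalemxAl vP mul_mx_scalar -scalerDl !hornerE.
Qed.

Lemma horner_perm_mxOver k :
  k \is a polyOver S -> horner_mx P k \is a mxOver S.
Proof.
move=> Sk; rewrite -[k]coefK poly_def rmorph_sum rpred_sum // => i _.
rewrite -mul_polyC rmorphM rmorphXn /= horner_mx_X horner_mx_C perm_mxX.
rewrite -mulmxE mul_scalar_mx mxOverZ ?(polyOverP Sk) //.
by apply/mxOverP=> a b; rewrite !mxE rpred_nat.
Qed.

Lemma porbit_stable i j : (s i \in porbit s j) = (i \in porbit s j).
Proof.
by have:= porbit_perm s 1 i; rewrite expg1 ![_ \in porbit s j]porbit_sym => ->.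
Qed.

Lemma dvdn_porbit_nfix i : s i != i -> (p %| #|porbit s i|)%N.
Proof.
move=> nfix; have /dvdn_pfactor: (#|porbit s i| %| p ^ e)%N.
  rewrite porbitE; apply: dvdn_trans (dvdn_orbit _ _ _) _.
  by rewrite -orderE order_dvdn sq1.
case/(_ p_pr) => [[|m] _ Dm]; last by rewrite Dm expnS dvdn_mulr.
have /cards1P[j Dj]: #|porbit s i| == 1%N by rewrite Dm.
have:= mem_porbit s 1 i; have:= porbit_id s i; rewrite expg1 Dj !inE.
by move/eqP <-; rewrite (negPf nfix).
Qed.

(* On a moved orbit O the block J E J of E, with J = J O, is J f(P) for some
   f over S with f(1) = sum_(a in O) E i0 a, so it has an inverse J k(P). *)
Lemma split_orbit_loc_idem A E i0 (O := porbit s i0) :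
    loc_idem A E -> s i0 != i0 -> \sum_(a in O) E i0 a \notin loc_max maxM ->
  exists F, [/\ loc_idem (A :\: O) F, \tr (F *m P) = \tr (E *m P)
              & fix_cong E F].
Proof.
move=> [SE EE EP AE EA] nfix m'E.
(* [d b] is an exponent of s carrying [i0] to b; outside O the value 0 is a placeholder. *)
have /fin_all_exists[d Dd] b : exists k, b \in O -> (s ^+ k)%g i0 = b.
  have [/porbitP[k ->]|_] := boolP (b \in O); first by exists k.
  by exists 0%N.
have sO i : (s i \in O) = (i \in O) by apply: porbit_stable.
have sEk k i j : E ((s ^+ k)%g i) ((s ^+ k)%g j) = E i j.
  elim: k => [|k IHk]; first by rewrite !perm1.
  by rewrite expgSr !permM (comm_perm_mxP _).1.
(* As E commutes with P, its block on O is determined by row [i0], whose entries become the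
   coefficients of f. *)
pose f := \sum_(b in O) E i0 b *: 'X^(d b).
have Sf: f \is a polyOver S.
  by rewrite rpred_sum // => b _;
  rewrite polyOverZ ?rpredX ?polyOverX ?(mxOverP SE).
have Df1: f.[1] = \sum_(a in O) E i0 a.
  rewrite horner_sum; apply: eq_bigr => b _.
  by rewrite hornerZ hornerXn expr1n mulr1.
have [|k Sk dvd_fk] := poly_inv_mod_Xn_sub_1 Sf; first by rewrite Df1.
pose fP := horner_mx P f; pose kP := horner_mx P k; pose JO := J O.
have fk1: fP *m kP = 1%:M.
  have /dvdpP[h Dh] := dvd_fk; apply/esym/eqP.
  rewrite -[1%:M](rmorph1 (horner_mx P)) mulmxE -rmorphM -subr_eq0 -rmorphB.
  rewrite Dh rmorphM rmorphB rmorph1 rmorphXn /= horner_mx_X perm_mxX sq1.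
  by rewrite perm_mx1 subrr mulr0.
have cJP: JO *m P = P *m JO by apply: comm_proj_mx_on.
have cJf: JO *m fP = fP *m JO by apply: comm_mx_horner.
have cJk: JO *m kP = kP *m JO by apply: comm_mx_horner.
have cEk: E *m kP = kP *m E by apply: comm_mx_horner.
have JJ: JO *m JO = JO by rewrite proj_mx_onM setIid.
have JEJ: JO *m E *m JO = fP *m JO.
  apply/matrixP=> i j; rewrite !mul_mx_proj_on mul_proj_mx_on.
  have [jO|] := boolP (j \in O); last by rewrite !mulr0.
  rewrite !mulr1 /fP rmorph_sum summxE.
  under eq_bigr => b _ do
    rewrite -mul_polyC rmorphM rmorphXn /= horner_mx_X horner_mx_C perm_mxX
            -mulmxE mul_scalar_mx 3!mxE.
  have [/porbitP[l Di] | O'i] := boolP (i \in O); last first.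
    rewrite mul0r big1 // => b _; case: eqP => [Dj|_]; last by rewrite mulr0.
    case/negP: O'i.
    by rewrite /O porbit_sym -(porbit_perm s (d b)) Dj porbit_sym.
  (* Here i is the image of [i0] under s^l, so for b in O the power P^(d b) is nonzero at (i, j)
     exactly when s^l b = j, that is, b = [b0]. *)
  pose b0 := ((s ^+ l)^-1)%g j; have sb0: (s ^+ l)%g b0 = j by rewrite permKV.
  have Ob0: b0 \in O.
    by rewrite /O porbit_sym -(porbit_perm s l) sb0 porbit_sym.
  rewrite mul1r Di -sb0 sEk (bigD1 b0) //= big1 ?addr0 => [|b /andP[Ob nb]].
    by rewrite -permM -expgD addnC expgD permM Dd // eqxx mulr1.
  rewrite -permM -expgD addnC expgD permM Dd // (inj_eq perm_inj).
  by rewrite (negPf nb) mulr0.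
have kf1: kP *m fP = 1%:M by rewrite -fk1; apply: comm_horner_mx2.
(* B inverts the block [JO] E [JO] in the corner cut out by [JO]. *)
pose B := JO *m kP.
have BEB: B *m E *m B = B.
  rewrite /B !mulmxA -(mulmxA JO kP E) -cEk mulmxA -(mulmxA _ kP JO) -cJk.
  by rewrite mulmxA JEJ -cJf -(mulmxA JO fP kP) fk1 mulmx1.
have cBP: B *m P = P *m B.
  rewrite /B -mulmxA (_ : kP *m P = P *m kP) ?mulmxA ?cJP //.
  exact: comm_horner_mx.
have JEB: JO *m E *m B = JO.
  by rewrite /B mulmxA JEJ -cJf -mulmxA fk1 mulmx1.
have BEJ: B *m E *m JO = JO.
  by rewrite /B cJk -!mulmxA (mulmxA JO) JEJ mulmxA kf1 mul1mx.
have DB : B = kP *m JO by rewrite /B cJk.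
have JB : JO *m B = B by rewrite /B mulmxA JJ.
have SB : B \is a mxOver S.
  apply/mxOverP=> i j; rewrite mul_proj_mx_on rpredM ?rpred_nat //.
  exact/mxOverP/horner_perm_mxOver.
(* Since B E B = B, the product E B E is idempotent, and F is its complement in E. The identities J
   E B = J = B E J, with J = [JO], clear the rows and columns of F in O. *)
clearbody B; pose F := E - E *m B *m E.
have JF: JO *m F = 0 by rewrite mulmxBr !mulmxA JEB subrr.
have FJ: F *m JO = 0.
  by rewrite mulmxBl -!mulmxA (mulmxA B) BEJ subrr.
exists F; split; first split.
- by rewrite rpredB // !mxOverM.
- have XX: E *m B *m E *m (E *m B *m E) = E *m B *m E.
    rewrite !mulmxA -(mulmxA _ E E) EE -(mulmxA E B E).
    by rewrite -(mulmxA E (B *m E) B) BEB mulmxA.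
  by rewrite mulmxBl !mulmxBr EE XX !mulmxA EE -(mulmxA _ E E) EE subrr subr0.
- by rewrite mulmxBl mulmxBr EP -!mulmxA EP (mulmxA B) cBP !mulmxA EP.
- rewrite proj_mx_onD mulmxBl -mulmxA; rewrite (_ : J A *m F = F) ?JF ?subr0 //.
  by rewrite mulmxBr !mulmxA AE.
- have FA: F *m J A = F by rewrite mulmxBl -!mulmxA EA mulmxA.
  rewrite proj_mx_onD proj_mx_onM setIC -proj_mx_onM mulmxBr mulmxA.
  by rewrite FA FJ subr0.
(* By cyclicity the trace of E B E P is that of B E J P = J P, which is 0 since s moves every point
   of O. *)
- rewrite mulmxBl raddfB /= (_ : \tr (E *m B *m E *m P) = 0) ?subr0 //.
  rewrite -mulmxA -mulmxA mxtrace_mulC -!mulmxA -EP (mulmxA E E P) EE.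
  rewrite -JB -mulmxA mxtrace_mulC -!mulmxA -cJP !mulmxA BEJ.
  rewrite /mxtrace big1 // => i _; rewrite mul_proj_mx_on !mxE.
  have [/porbitP[k' ->]|_] := boolP (i \in O); last by rewrite mul0r.
  rewrite -permM -expgSr expgS permM (inj_eq perm_inj) (negPf nfix).
  by rewrite mulr0.
(* For fixed i and j the entries E i a and E a j do not depend on a in O. Hence E B E has entry k(1)
   |O| (E i i0) (E i0 j) at (i, j), and p divides |O|. *)
move=> i j si sj.
have Eic a : a \in O -> E i a = E i i0.
  case/porbitP=> l ->; rewrite -[RHS](sEk l); congr (E _ _).
  by elim: l => [|l IHl]; rewrite ?perm1 // expgSr permM -IHl.
have Eci a : a \in O -> E a j = E i0 j.
  case/porbitP=> l ->; rewrite -[RHS](sEk l); congr (E _ _).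
  by elim: l => [|l IHl]; rewrite ?perm1 // expgSr permM -IHl.
have viP: row i E *m P = row i E.
  by rewrite -row_mul EP; apply/rowP=> a; rewrite mxE mul_perm_mxE si mxE.
have -> : F i j - E i j = - (k.[1] * #|O|%:R * (E i i0 * E i0 j)).
  have EBi a : (E *m B) i a = k.[1] * E i a * (a \in O)%:R.
    rewrite DB mulmxA mul_mx_proj_on; congr (_ * _).
    have:= congr1 (fun v : 'rV[algC]_n.+1 => v 0 a) (row_fix_horner_mx k viP).
    by rewrite -row_mul !mxE => ->.
  rewrite [F i j]mxE addrC addKr mxE; congr (- _).
  rewrite mxE (bigID (mem O)) /= [X in _ + X]big1 ?addr0; last first.
    by move=> a O'a; rewrite EBi (negPf O'a) mulr0 mul0r.
  rewrite (eq_bigr (fun=> k.[1] * E i i0 * E i0 j)) => [|a Oa].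
    by rewrite sumr_const -mulr_natr; ring.
  by rewrite EBi Oa mulr1 Eic // Eci.
rewrite loc_maxN -mulrA loc_maxM ?rpred_horner ?rpred1 //.
rewrite loc_maxMr ?rpredM ?(mxOverP SE) //.
have /dvdnP[m ->] := dvdn_porbit_nfix nfix.
by rewrite natrM loc_maxM ?ideal_loc_max ?rpred_nat.
Qed.

(* E is split over the orbits of s: the row sums of E and of J A - E over an
   orbit add up to 1, so one of these idempotents splits off that orbit. *)
Lemma loc_idem_fix (A : {set 'I_n.+1}) E :
    (forall i, (s i \in A) = (i \in A)) -> loc_idem A E ->
  exists (B : {set _}) F, [/\ forall i, i \in B -> s i = i, loc_idem B F,
                  \tr F = \tr (E *m P) & fix_cong E F].
Proof.
have [m] := ubnP #|A|; elim: m => // m IHm in A E *.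
rewrite ltnS => leAm sA idE.
(* If s fixes A pointwise, then E P = E and E itself serves; otherwise an orbit is removed from
   A. *)
have [/existsP[i0 /andP[Ai0 nfix]] | /existsPn fixA] :=
    boolP [exists i, (i \in A) && (s i != i)]; last first.
  have Afix i : i \in A -> s i = i.
    by move=> Ai; apply/eqP; move: (fixA i); rewrite Ai /= negbK.
  exists A, E; split=> //; last by move=> i j _ _; rewrite subrr rpred0.
  case: idE => _ _ _ _ EA; rewrite -{2}EA -mulmxA (_ : J A *m P = J A) ?EA //.
  apply/matrixP=> i j; rewrite mul_proj_mx_on !mxE.
  by have [/Afix->|] := boolP (i \in A); rewrite ?mul1r // mul0r mul0rn.
pose O := porbit s i0.
have sO i : (s i \in O) = (i \in O) by apply: porbit_stable.
have Oi0 : i0 \in O by apply: porbit_id.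
have sA' i : (s i \in A :\: O) = (i \in A :\: O) by rewrite !inE sA sO.
have ltA'm : (#|A :\: O| < m)%N.
  apply: leq_trans leAm; apply: proper_card; apply/properP; split.
    exact: subsetDl.
  by exists i0; rewrite // inE Oi0.
have fixO i : s i = i -> i \notin O.
  move=> si; apply/negP=> /porbitP[k Di]; case/eqP: nfix.
  by apply: (@perm_inj _ (s ^+ k)%g); rewrite -permM -expgS expgSr permM -Di.
have [mE | m'E] := boolP (\sum_(a in O) E i0 a \in loc_max maxM); last first.
  have [F [idF tF cF]] := split_orbit_loc_idem idE nfix m'E.
  have [B [F' [fixB idF' tF' cF']]] := IHm _ _ ltA'm sA' idF.
  exists B, F'; split=> //; first by rewrite tF'.
  by move=> i j si sj; rewrite -[F' i j](subrK (F i j)) -addrA rpredD ?cF ?cF'.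
have m'1E : \sum_(a in O) (J A - E) i0 a \notin loc_max maxM.
  have D1 : \sum_(a in O) (J A - E) i0 a + \sum_(a in O) E i0 a = 1.
    rewrite -big_split (bigD1 i0) //= big1 => [|a /andP[_ i0'a]].
      by rewrite !mxE subrK addr0 Ai0 eqxx.
    by rewrite !mxE subrK eq_sym (negPf i0'a).
  by apply/negP=> m1E; case/negP: (loc_max1 maxM); rewrite -D1 rpredD.
(* The orbit is split off [J A] - E, and the complement of the result in [A :\: O] replaces E. The
   trace is kept because s fixes no point of O. *)
have [F [idF tF cF]] := split_orbit_loc_idem (loc_idem_compl sA idE) nfix m'1E.
have [B [F' [fixB idF' tF' cF']]] := IHm _ _ ltA'm sA' (loc_idem_compl sA' idF).
exists B, F'; split=> // [|i j si sj].
  rewrite tF' mulmxBl raddfB /= tF mulmxBl raddfB /= opprB addrCA.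
  rewrite [X in _ + X](_ : _ = 0) ?addr0 //.
  apply/eqP; rewrite subr_eq0; apply/eqP.
  rewrite /mxtrace; apply: eq_bigr => i _; rewrite !mul_proj_mx_on !mxE !inE.
  by case: eqP => [/fixO->//|_]; rewrite !mulr0.
have -> : F' i j - E i j
    = (F' i j - (J (A :\: O) - F) i j) - (F i j - (J A - E) i j).
  by rewrite !mxE !inE (fixO i si) /=; ring.
by rewrite loc_maxB ?cF ?cF'.
Qed.

End LocalIdempotent.

(** In a full-rank factorization E = C R, cancelling in C R C R = C R gives R C = 1, and E has the
    trace of R C. *)
Lemma mxtrace_idempotent (K : fieldType) n (E : 'M[K]_n) :
  E *m E = E -> \tr E = (\rank E)%:R.
Proof.
move=> EE; rewrite -{1}(mulmx_base E) mxtrace_mulC.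
suffices -> : row_base E *m col_base E = 1%:M by rewrite mxtrace1.
apply: (row_free_inj (row_base_free E)).
apply: (row_full_inj (col_base_full E)).
by rewrite mul1mx -(mulmxA (row_base E)) (mulmxA (col_base E)) !mulmx_base.
Qed.

(** * Traces of local idempotents multiplied by a permutation *)

Section LocalIdempotentTrace.

Variables (M : {pred algC}) (maxM : Aint_maximal_ideal M).
Variables (p e : nat) (p_pr : prime p) (Mp : p%:R \in M).
Variables (n : nat) (s : 'S_n.+1) (sq1 : (s ^+ (p ^ e) = 1)%g).
Variable E : 'M[algC]_n.+1.
Hypotheses (SE : E \is a mxOver (loc_Aint maxM)) (EE : E *m E = E).
Hypothesis sE : forall i j, E (s i) (s j) = E i j.

Let loc_idem_setT_fix : exists (B : {set _}) F,
  [/\ forall i, i \in B -> s i = i, loc_idem maxM s B F,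
      \tr F = \tr (E *m perm_mx s) & fix_cong maxM s E F].
Proof.
apply: (loc_idem_fix p_pr Mp sq1 (A := setT)) => [i|]; first by rewrite !inE.
have J1 : proj_mx_on [set: 'I_n.+1] = 1%:M.
  by apply/matrixP=> i j; rewrite !mxE inE.
by split; rewrite ?J1 ?mul1mx ?mulmx1 //; apply/comm_perm_mxP.
Qed.

(** The support B of F consists of fixed points, so it is empty and F = 0. *)
Lemma mxtrace_loc_idem_nfix : (forall i, s i != i) -> \tr (E *m perm_mx s) = 0.
Proof.
move=> nfix; have [B [F [fixB [_ _ _ BF _] <- _]]] := loc_idem_setT_fix.
rewrite -BF (_ : proj_mx_on B = 0) ?mul0mx ?linear0 //.
apply/matrixP=> i j; rewrite !mxE; case: (boolP (i \in B)) => [/fixB si|].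
  by case/eqP: (nfix i).
by rewrite mul0rn.
Qed.

(** The trace of F is its rank, so F = 0 in characteristic 0. By contraposition, an entry of E
    outside MS at a pair of fixed points makes the trace nonzero. *)
Lemma mxtrace_loc_idem_eq0 i j : \tr (E *m perm_mx s) = 0 ->
  s i = i -> s j = j -> E i j \in loc_max maxM.
Proof.
move=> tr0 si sj; have [B [F [_ [_ FF _ _ _] trF cF]]] := loc_idem_setT_fix.
have F0 : F = 0.
  apply/eqP; rewrite -mxrank_eq0 -(pnatr_eq0 algC) -mxtrace_idempotent //.
  by rewrite trF tr0.
by have:= cF i j si sj; rewrite F0 mxE add0r loc_maxN.
Qed.

End LocalIdempotentTrace.

(** By Schur's lemma the matrices of the x^a sum to a scalar c. Traces give c chi(1) = |G| chi(x),
    and the left-hand side is c chi(u). *)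
Lemma sum_irr_mul_conj (gT : finGroupType) (G : {group gT}) (i : Iirr G) u x :
    u \in G -> x \in G ->
  \sum_(a in G) 'chi_i (u * x ^ a)%g
    = #|G|%:R * 'chi_i u * 'chi_i x / 'chi_i 1%g.
Proof.
move=> Gu Gx; pose rG := 'Chi_i; pose A := \sum_(a in G) rG (x ^ a)%g.
have chiE y : y \in G -> 'chi_i y = \tr (rG y).
  by move=> Gy; rewrite -irrRepr cfunE Gy.
have /is_scalar_mxP[c Ac]: is_scalar_mx A.
  apply: (mx_abs_irr_cent_scalar (groupC (socle_irr _))).
  apply/centgmxP=> y Gy; rewrite mulmx_suml mulmx_sumr.
  rewrite [RHS](reindex_inj (mulIg y)); apply: eq_big => [a | a Ga] /=.
    by rewrite groupMr.
  by rewrite -!repr_mxM ?groupJ ?groupM // conjgM -conjgC.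
have trA : \tr A = #|G|%:R * 'chi_i x.
  rewrite raddf_sum -sumr_const mulr_suml; apply: eq_bigr => a Ga /=.
  by rewrite mul1r -chiE ?groupJ ?cfunJ.
transitivity (\tr (rG u *m A)).
  rewrite mulmx_sumr raddf_sum; apply: eq_bigr => a Ga.
  by rewrite -repr_mxM ?groupJ //; apply: chiE; rewrite groupM ?groupJ.
have chi1 : 'chi_i 1%g = (irr_degree (socle_of_Iirr i))%:R.
  by rewrite chiE // repr_mx1 mxtrace1.
apply: (mulIf (irr1_neq0 i)); rewrite divfK ?irr1_neq0 //.
rewrite mulrAC -trA Ac mul_mx_scalar mxtraceZ mxtrace_scalar -chiE // chi1.
by rewrite mulrAC mulr_natr.
Qed.

(** * The center of the group algebra acting on the regular module *)

Section RegularIdempotents.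

Variables (gT : finGroupType) (G : {group gT}) (n : nat).
Hypothesis cardG : #|G| = n.+1.

Definition elt (a : 'I_n.+1) : gT := enum_val (cast_ord (esym cardG) a).

Lemma eltG a : elt a \in G.
Proof. exact: enum_valP. Qed.

Lemma elt_inj : injective elt.
Proof. by move=> a b /enum_val_inj/cast_ord_inj. Qed.

Lemma eltP g : g \in G -> exists a, elt a = g.
Proof.
move=> Gg; exists (cast_ord cardG (enum_rank_in Gg g)).
by rewrite /elt cast_ordK enum_rankK_in.
Qed.

Lemma sum_elt (F : gT -> algC) : \sum_a F (elt a) = \sum_(g in G) F g.
Proof.
rewrite [RHS]big_enum_val (reindex (cast_ord (esym cardG))) //.
apply: onW_bij; exists (cast_ord cardG); first exact: cast_ordKV.
exact: cast_ordK.
Qed.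

(** Multiplication by the central idempotent of chi_i in the basis G: entry (a, b) is the
    coefficient of [elt a] in the product of the idempotent with [elt b]. *)
Definition irr_idem (i : Iirr G) : 'M[algC]_n.+1 :=
  \matrix_(a, b) ('chi_i 1%g / #|G|%:R * 'chi_i ((elt a)^-1 * elt b)%g).

Lemma irr_idemM i j : irr_idem i *m irr_idem j = (i == j)%:R *: irr_idem i.
Proof.
apply/matrixP=> a b; rewrite !mxE.
have Gab : ((elt a)^-1 * elt b)%g \in G by rewrite groupM ?groupV ?eltG.
have := generalized_orthogonality_relation ((elt a)^-1 * elt b)%g j i.
rewrite eq_sym => DE.
transitivity ('chi_i 1%g * 'chi_j 1%g / #|G|%:R * ((i == j)%:R *
               ('chi_j ((elt a)^-1 * elt b)%g / 'chi_j 1%g))).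
  rewrite -DE mulrA mulr_sumr.
  rewrite [RHS](reindex_inj invg_inj) [RHS](reindex_inj (mulgI (elt a)^-1%g)).
  under [RHS]eq_bigl => x do rewrite groupV groupMl ?groupV ?eltG //.
  rewrite -sum_elt; apply: eq_bigr => c _ /=; rewrite !mxE invgK.
  rewrite invMg invgK -mulgA mulKVg.
  by field; rewrite neq0CG.
have [<-|_] := eqVneq i j; last by rewrite mulr0n !mul0r mulr0.
by field; rewrite irr1_neq0 neq0CG.
Qed.

Lemma sum_irr_idem : \sum_i irr_idem i = 1%:M.
Proof.
apply/matrixP=> a b; rewrite summxE mxE.
have := congr1 (fun f : 'CF(G) => f ((elt a)^-1 * elt b)%g) (cfReg_sum G).
rewrite cfRegE sum_cfunE -eq_mulVg1 (inj_eq elt_inj) => DE.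
have -> : (a == b)%:R = #|G|%:R^-1 * (#|G|%:R *+ (a == b)) :> algC.
  by rewrite mulrnAr mulVf ?neq0CG.
rewrite DE mulr_sumr; apply: eq_bigr => i _.
by rewrite mxE cfunE mulrA [_ / _]mulrC.
Qed.

(** The action of the central element at which the central character of chi_i takes the value [y i];
    products become pointwise. *)
Definition spec (y : Iirr G -> algC) := \sum_i y i *: irr_idem i.

Lemma spec1 : spec (fun=> 1) = 1%:M.
Proof. by rewrite -sum_irr_idem; apply: eq_bigr => i _; rewrite scale1r. Qed.

Lemma specM y z : spec y *m spec z = spec (fun i => y i * z i).
Proof.
rewrite mulmx_suml; apply: eq_bigr => i _; rewrite mulmx_sumr (bigD1 i) //=.
rewrite big1 => [|j i'j]; rewrite -scalemxAl -scalemxAr irr_idemM.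
  by rewrite eqxx scale1r addr0 scalerA.
by rewrite eq_sym (negPf i'j) scale0r !scaler0.
Qed.

Lemma specB y z : spec y - spec z = spec (fun i => y i - z i).
Proof. by rewrite -sumrB; apply: eq_bigr => i _; rewrite scalerBl. Qed.

Lemma specZ c y : c *: spec y = spec (fun i => c * y i).
Proof. by rewrite scaler_sumr; apply: eq_bigr => i _; rewrite scalerA. Qed.

Lemma specE y a b : spec y a b =
  \sum_i y i * ('chi_i 1%g / #|G|%:R * 'chi_i ((elt a)^-1 * elt b)%g).
Proof. by rewrite summxE; apply: eq_bigr => i _; rewrite !mxE. Qed.

(** This matrix is the action of a class sum, so its entries are 0 or 1, as the second orthogonality
    relation shows. *)
Lemma spec_omega_Aint k : spec (fun i => 'omega_i['K_k]) \is a mxOver Aint.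
Proof.
apply/mxOverP=> a b; rewrite specE.
have /imsetP[g Gg Dk] := enum_valP k.
have kg : g \in enum_val k by rewrite Dk class_refl.
set y := (_ * _)%g.
have -> : \sum_i 'omega_i['K_k] * ('chi_i 1%g / #|G|%:R * 'chi_i y)
    = #|g ^: G|%:R / #|G|%:R * (#|'C_G[y]|%:R *+ (y \in (g^-1)%g ^: G)).
  rewrite -second_orthogonality_relation ?groupV // mulr_sumr.
  apply: eq_bigr => i _; rewrite (gring_mode_class_sum_eq _ kg).
  by rewrite char_inv ?irr_char // conjCK; field; rewrite irr1_neq0 neq0CG.
case: imsetP => [[h Gh ->] | _]; last by rewrite mulr0n mulr0 rpred0.
rewrite mulr1n -[#|g ^: G|]index_cent1 -divgS ?subsetIl //.
have -> : #|'C_G[(g^-1 ^ h)%g]| = #|'C_G[g]|.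
  by rewrite cent1J -{1}(conjGid Gh) -conjIg cardJg -!cent_cycle cycleV.
rewrite (pchar0_natf_div Cpchar) ?cardSg ?subsetIl //.
by rewrite mulrAC divfK ?neq0CG // divff ?neq0CG ?rpred1.
Qed.

Lemma eq_spec y z : y =1 z -> spec y = spec z.
Proof. by move=> yz; apply: eq_bigr => i _; rewrite yz. Qed.

Definition block_idem (B : {set Iirr G}) := spec (fun i => (i \in B)%:R).

Lemma block_idemM B : block_idem B *m block_idem B = block_idem B.
Proof.
by rewrite specM; apply: eq_spec => i; case: (i \in B); rewrite ?mul1r ?mul0r.
Qed.

Lemma block_idemE B a b :
  block_idem B a b = block_coef B ((elt b)^-1 * elt a)%g.
Proof.
rewrite specE /block_coef mulr_sumr [RHS]big_mkcond /=; apply: eq_bigr => i _.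
rewrite invMg invgK; case: (i \in B); rewrite ?mul0r //.
by rewrite mul1r mulrA [_ / _]mulrC.
Qed.

Section BlockTrace.

Variables (x z : gT) (Gx : x \in G) (Gz : z \in G).

Let shift_subproof a : exists b, elt b == (x^-1 * elt a * z)%g.
Proof.
have [|b <-] := @eltP (x^-1 * elt a * z)%g; last by exists b.
by rewrite !groupM ?groupV ?eltG.
Qed.

Let shift a := xchoose (shift_subproof a).

Let eltshift a : elt (shift a) = (x^-1 * elt a * z)%g.
Proof. exact/eqP/(xchooseP (shift_subproof a)). Qed.

Let shift_inj : injective shift.
Proof.
move=> a b /(congr1 elt); rewrite !eltshift => /mulIg/mulgI.
exact: elt_inj.
Qed.

(** [perm_mx s] sends the basis column at b to the one at s^-1 b, so s is the inverse of a |-> x a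
    z^-1. *)
Definition biregular_perm : 'S_n.+1 := perm shift_inj.

Lemma biregular_permE a : elt (biregular_perm a) = (x^-1 * elt a * z)%g.
Proof. by rewrite permE eltshift. Qed.

Lemma biregular_permX1 q : (x ^+ q = 1)%g -> (z ^+ q = 1)%g ->
  (biregular_perm ^+ q = 1)%g.
Proof.
move=> xq zq; apply/permP=> a; rewrite perm1; apply: elt_inj.
suffices ->: elt ((biregular_perm ^+ q)%g a) = (x ^- q * elt a * z ^+ q)%g.
  by rewrite xq zq invg1 mul1g mulg1.
elim: q {xq zq} => [|q IHq]; first by rewrite perm1 invg1 mul1g mulg1.
by rewrite expgSr permM biregular_permE IHq !expgSr invMg !mulgA.
Qed.

Lemma biregular_perm_fix a : (biregular_perm a == a) = (x ^ elt a == z)%g.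
Proof.
rewrite -(inj_eq elt_inj) biregular_permE /conjg -mulgA.
rewrite -(inj_eq (mulgI x)) mulKVg -(inj_eq (mulgI (elt a)^-1%g)) mulKg.
by rewrite eq_sym.
Qed.

Lemma block_idem_biregular B a b :
  block_idem B (biregular_perm a) (biregular_perm b) = block_idem B a b.
Proof.
rewrite !specE; apply: eq_bigr => i _; rewrite !biregular_permE.
rewrite -['chi_i ((elt a)^-1 * elt b)%g](cfunJ _ _ Gz).
congr (_ * (_ * 'chi_i _)).
by rewrite !invMg invgK /conjg !mulgA mulgK.
Qed.

(** The diagonal entry at a is the sum over B of chi(1) / |G| times chi(z^-1 x^a);
    [sum_irr_mul_conj] evaluates the sum over a. *)
Lemma mxtrace_block_idem B :
  \tr (block_idem B *m perm_mx biregular_perm)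
    = \sum_(i in B) 'chi_i (z^-1)%g * 'chi_i x.
Proof.
rewrite mxtrace_mulC /mxtrace.
under eq_bigr => a _ do
  rewrite -row_permE mxE specE biregular_permE !invMg invgK !mulgA.
rewrite exchange_big [RHS]big_mkcond /=; apply: eq_bigr => i _.
rewrite -mulr_sumr; case: (i \in B); last by rewrite mul0r.
rewrite mul1r -mulr_sumr.
have := sum_irr_mul_conj i (groupVr Gz) Gx; rewrite -sum_elt => DE.
under eq_bigr => a _ do rewrite -!mulgA -/(x ^ elt a)%g.
by rewrite DE; field; rewrite irr1_neq0 neq0CG.
Qed.

End BlockTrace.

(** * Integrality of block idempotents over S *)

Section BlockLocal.

Variables (M : {pred algC}) (maxM : Aint_maximal_ideal M).

Let S := loc_Aint maxM.

Lemma spec_prod_loc (I : Type) (r : seq I) (Q : pred I)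
    (y : I -> Iirr G -> algC) :
    (forall j, Q j -> spec (y j) \is a mxOver S) ->
  spec (fun i => \prod_(j <- r | Q j) y j i) \is a mxOver S.
Proof.
move=> Sy; elim: r => [|j r IHr].
  rewrite (eq_spec (z := fun=> 1)) => [|i]; last by rewrite big_nil.
  by rewrite spec1 mxOver_scalar ?rpred0 ?rpred1.
pose yr i := \prod_(l <- r | Q l) y l i; have [Qj | Q'j] := boolP (Q j).
  rewrite (eq_spec (z := fun i => y j i * yr i)) => [|i].
    by rewrite -specM mxOverM ?Sy.
  by rewrite big_cons Qj.
by rewrite (eq_spec (z := yr)) // => i; rewrite big_cons (negPf Q'j).
Qed.

(* The element nu with omega_i(nu) = prod_(j notin B) (omega_i - omega_j)(K_j)
   for suitable classes K_j vanishes off B and is a unit mod MS on B, whence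
   e_B = 1 - prod_(j in B) (1 - nu / omega_j(nu)). *)
Lemma block_idem_loc B : is_block M B -> block_idem B \is a mxOver S.
Proof.
case=> i0 DB.
have inB i : (i \in B) = same_block M i0 i by rewrite DB inE.
(* For j outside B, [k j] is a class separating [i0] from j modulo M; for j in B the class of 1 is a
   placeholder. *)
have /fin_all_exists[k Dk] j : exists k : 'I_#|classes G|,
    j \notin B -> 'omega_i0['K_k] - 'omega_j['K_k] \notin M.
  have [Bj | ] := boolP (j \in B).
    by exists (enum_rank_in (classes1 G) 1%g).
  by rewrite inB => /forallPn[k Mk]; exists k.
pose nu i := \prod_(j | j \notin B) ('omega_i['K_(k j)] - 'omega_j['K_(k j)]).
have Aomega i l : 'omega_i['K_l] \in S.
  exact/Aint_loc/Aint_gring_mode_class_sum.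
have Snu i : nu i \in S by rewrite rpred_prod // => j _; rewrite rpredB.
have nuB i : i \in B -> nu i \notin loc_max maxM.
  (* The central characters of i and [i0] agree modulo M, so the factors that are units at [i0] are
     units at i. *)
  move=> Bi; apply: loc_max_prod => j B'j; rewrite rpredB //=.
  have:= Dk j B'j; rewrite -(Aint_loc_max maxM)
    ?rpredB ?Aint_gring_mode_class_sum //.
  apply: contra => mij; rewrite -(subrK 'omega_i['K_(k j)] 'omega_i0['K_(k j)]).
  rewrite -addrA rpredD // ideal_loc_max //.
  by have:= Bi; rewrite inB => /forallP.
have nuB' i : i \notin B -> nu i = 0.
  by move=> B'i; rewrite /nu (bigD1 i) //= subrr mul0r.
have spec_nu : spec nu \is a mxOver S.
  apply: spec_prod_loc => j _; rewrite -specB rpredB //.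
    exact: (mxOverS (@Aint_loc _ maxM)) (spec_omega_Aint _).
  rewrite (_ : spec _ = ('omega_j['K_(k j)])%:M) ?mxOver_scalar ?rpred0 //.
  rewrite -scalemx1 -spec1 specZ; apply: eq_spec => i.
  by rewrite mulr1.
have -> : block_idem B
    = spec (fun i => 1 - \prod_(j in B) (1 - (nu j)^-1 * nu i)).
  apply: eq_spec => i; have [Bi | B'i] := boolP (i \in B).
    rewrite (bigD1 i) //= mulVf ?subrr ?mul0r ?subr0 //.
    by apply: contraNneq (nuB i Bi) => ->; apply: rpred0.
  rewrite (nuB' i B'i) big1 ?subrr // => j _.
  by rewrite mulr0 subr0.
rewrite -specB spec1 rpredB ?mxOver_scalar ?rpred0 ?rpred1 //.
apply: spec_prod_loc => j Bj; rewrite -specB spec1 -specZ.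
rewrite rpredB ?mxOver_scalar ?mxOverZ ?rpred0 ?rpred1 //.
by rewrite loc_unit ?nuB.
Qed.

End BlockLocal.

End RegularIdempotents.

(** * Character sums over a block at p-elements, and real elements *)

Lemma sum_block_sqr_nreal (p : nat) (p_prime : prime p) (gT : finGroupType)
    (G : {group gT}) (M : {pred algC}) (maxM : Aint_maximal_ideal M)
    (pM : p%:R \in M) (B : {set Iirr G}) (blockB : is_block M B) x :
    x \in G -> p.-elt x -> ~ real_in G x -> \sum_(i in B) 'chi_i x ^+ 2 = 0.
Proof.
move=> Gx p_x nreal; have [n cardG]: exists n, #|G| = n.+1.
  by exists #|G|.-1; rewrite prednK ?cardG_gt0.
have [e ox] := p_natP p_x.
have GVx : x^-1%g \in G by rewrite groupV.
have xe : (x ^+ (p ^ e) = 1)%g by rewrite -ox expg_order.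
have xVe : (x^-1 ^+ (p ^ e) = 1)%g by rewrite expgVn xe invg1.
have sq1 := biregular_permX1 cardG Gx GVx xe xVe.
have := mxtrace_loc_idem_nfix p_prime pM sq1 (block_idem_loc cardG maxM blockB)
  (block_idemM _ _) (block_idem_biregular cardG Gx GVx B).
rewrite mxtrace_block_idem invgK; apply=> a.
rewrite biregular_perm_fix; apply/eqP=> xa; case: nreal.
by exists (elt cardG a); rewrite ?eltG.
Qed.

Lemma sum_block_norm_neq0 (p : nat) (p_prime : prime p) (gT : finGroupType)
    (G : {group gT}) (M : {pred algC}) (maxM : Aint_maximal_ideal M)
    (pM : p%:R \in M) (B : {set Iirr G}) (blockB : is_block M B) x g :
    x \in G -> p.-elt x -> g \in 'C_G[x] -> nonzero_mod M (block_coef B g) ->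
  \sum_(i in B) 'chi_i (x^-1)%g * 'chi_i x != 0.
Proof.
move=> Gx p_x /setIP[Gg /cent1P cxg] nzg; have [n cardG]: exists n, #|G| = n.+1.
  by exists #|G|.-1; rewrite prednK ?cardG_gt0.
have [e ox] := p_natP p_x.
have xe : (x ^+ (p ^ e) = 1)%g by rewrite -ox expg_order.
have sq1 := biregular_permX1 cardG Gx Gx xe xe.
have SB := block_idem_loc cardG maxM blockB.
(* The entry of the block idempotent in row g and column 1 is its coefficient at g, and both g and 1
   are fixed points since they commute with x. *)
have [a Da] := eltP cardG Gg; have [b Db] := eltP cardG (group1 G).
rewrite -(mxtrace_block_idem cardG Gx Gx); apply/eqP=> tr0.
have fixC c : commute x (elt cardG c) -> biregular_perm cardG Gx Gx c = c.
  by move=> cxc; apply/eqP; rewrite biregular_perm_fix conjgE cxc mulKg.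
have := mxtrace_loc_idem_eq0 p_prime pM sq1 SB (block_idemM _ _)
  (block_idem_biregular cardG Gx Gx B) tr0 (i := a) (j := b).
rewrite !fixC ?Da ?Db; last 2 first; [exact: commute1 | exact: commute_sym |].
move/(_ erefl erefl); apply/negP; apply: loc_max_nunit => //.
  exact/mxOverP.
by rewrite block_idemE Da Db invg1 mul1g.
Qed.

Theorem corollary26 (p : nat) (p_prime : prime p)
    (gT : finGroupType) (G : {group gT})
    (M : {pred algC}) (maxM : Aint_maximal_ideal M) (pM : (p%:R)%R \in M)
    (B : {set Iirr G}) (blockB : is_block M B)
    (D : {group gT}) (defectD : defect_group M p B D)
    (x : gT) (xD : x \in D) :
  block_real B x <-> real_in G x.
Proof.
have [k [[nzB _] [g kg sylD]]] := defectD.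
have p_x : p.-elt x by apply: mem_p_elt (pHall_pgroup sylD) xD.
(* D lies in the centralizer of the defect class element g, so x and g commute. *)
have /setIP[Gx cgx] := subsetP (pHall_sub sylD) x xD.
have Gg : g \in G.
  have /imsetP[h Gh Dk] := enum_valP k.
  by move: kg; rewrite Dk => /imsetP[u Gu ->]; rewrite groupJ.
have Cxg : g \in 'C_G[x] by rewrite inE Gg cent1C.
split=> [realB | [h Gh xh] i _]; last first.
  (* The complex conjugate of chi(x) is chi(x^-1) = chi(x^h) = chi(x). *)
  by rewrite CrealE -char_inv ?irr_char // -xh cfunJ.
apply: contra_notP (elimN eqP (sum_block_norm_neq0 p_prime maxM pM blockB
  Gx p_x Cxg (nzB g kg))) => nreal.
have sqr0 := sum_block_sqr_nreal p_prime maxM pM blockB Gx p_x nreal.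
(* Squares of real values are nonnegative, so [sqr0] forces chi(x) = 0 throughout B, and every term
   chi(x^-1) chi(x) vanishes. *)
rewrite big1 // => i Bi; apply/eqP; rewrite mulf_eq0 -[X in _ || X]sqrf_eq0.
rewrite (psumr_eq0P _ sqr0) ?eqxx ?orbT // => j Bj.
by rewrite real_exprn_even_ge0 ?realB.
Qed.
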